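(* For each $k\in\{1,2,3,4\}$ there exist infinitely many compact just-edge-transitive maps $\mathcal M_k$ without boundary, such that ${\rm Aut}\,\mathcal M_k$ contains exactly $k$ conjugacy classes of reflections. These maps can be chosen to be orientable or non-orientable (that is, for each $k$ there are infinitely many orientable such maps and infinitely many non-orientable such maps).
   Context: All maps (graphs embedded in surfaces; loops and multiple edges allowed) are connected. They are described algebraically as follows. Let $\Gamma=\langle R_0,R_1,R_2\mid R_0^2=R_1^2=R_2^2=(R_0R_2)^2=1\rangle$. A map $\mathcal M$ corresponds to a transitive (right) action of $\Gamma$ on a non-empty set $\Phi$, the set of flags (mutually incident vertex-edge-face triples) of $\mathcal M$, where $R_i$ sends each flag $\phi$ to the other flag sharing the same $j$-dimensional components for all $j\neq i$ if there is one, and fixes $\phi$ otherwise; every transitive $\Gamma$-set arises in this way. The vertices, edges and faces of $\mathcal M$ are the orbits on $\Phi$ of $\langle R_1,R_2\rangle$, $\langle R_0,R_2\rangle$ and $\langle R_0,R_1\rangle$ respectively, with incidence given by non-empty intersection. The map subgroups of $\mathcal M$ are the stabilisers $M\le\Gamma$ of flags (a conjugacy class of subgroups). The map is compact if and only if $\Phi$ is finite; it has non-empty boundary if and only if some $R_i$ fixes a flag; it is orientable and without boundary if and only if $M\le\Gamma^+$, the index-$2$ subgroup of $\Gamma$ consisting of the words of even length in $R_0,R_1,R_2$. The automorphism group ${\rm Aut}\,\mathcal M$ is the group of permutations of $\Phi$ commuting with the action of $\Gamma$ (it is isomorphic to $N_\Gamma(M)/M$). The map $\mathcal M$ is vertex-,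 edge- or face-transitive if ${\rm Aut}\,\mathcal M$ acts transitively on its vertices, edges or faces respectively. It is just-edge-transitive if it is edge-transitive but neither vertex-transitive nor face-transitive. A reflection of $\mathcal M$ is an automorphism (necessarily of order $2$) which fixes a point of the surface and acts as a reflection on a disc-shaped neighbourhood of that point; algebraically, it is an automorphism $r\ne 1$ such that $r(\phi)=\phi R_i$ for some flag $\phi\in\Phi$ and some $i\in\{0,1,2\}$ (equivalently, a non-identity automorphism induced by a conjugate of some $R_i$ lying in $N_\Gamma(M)$). Maps are counted up to isomorphism (isomorphism of $\Gamma$-sets). *)

(* Defs.v *)
From mathcomp Require Import all_boot all_fingroup.

Set Implicit Arguments.
Unset Strict Implicit.
Unset Printing Implicit Defensive.

Local Open Scope group_scope.

Definition i0 : 'I_3 := @Ordinal 3 0 isT.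
Definition i1 : 'I_3 := @Ordinal 3 1 isT.
Definition i2 : 'I_3 := @Ordinal 3 2 isT.

(* A compact map is a finite transitive set Phi acted upon by
     Gamma = < R0, R1, R2 | R0^2 = R1^2 = R2^2 = (R0 R2)^2 = 1 >;
   an action of Gamma on Phi is the same thing as three permutations of Phi
   satisfying the defining relations.  In {perm Phi}, (s * t) x = t (s x), so
   these are right actions.  Non-emptiness of Phi is part of [transitive ...]. *)
Record compact_map := CompactMap {
  flag : finType;
  R : 'I_3 -> {perm flag};
  R_invol : forall i, R i ^+ 2 = 1;
  R02_invol : (R i0 * R i2) ^+ 2 = 1;
  R_trans : [transitive <<[set R i | i : 'I_3]>>, on [set: flag] | 'P]
}.

Section Maps.

Variable M : compact_map.

(* The image of Gamma in the permutations of the flags. *)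
Definition monodromy : {group {perm flag M}} := <<[set R M i | i : 'I_3]>>%G.

(* The d-dimensional cells are the orbits of the R_i with i <> d. *)
Definition cells (d : 'I_3) : {set {set flag M}} :=
  [set orbit 'P <<[set R M i | i : 'I_3 & i != d]>> x | x : flag M].

Definition vertices := cells i0.
Definition edges := cells i1.
Definition faces := cells i2.

Definition Aut_map : {group {perm flag M}} := 'C(monodromy)%G.

Definition vertex_transitive : bool := [transitive Aut_map, on vertices | 'P^*].
Definition edge_transitive : bool := [transitive Aut_map, on edges | 'P^*].
Definition face_transitive : bool := [transitive Aut_map, on faces | 'P^*].

Definition just_edge_transitive : bool :=
  [&& edge_transitive, ~~ vertex_transitive & ~~ face_transitive].

Definition without_boundary : bool :=
  [forall i, forall x : flag M, R M i x != x].

(* The flag stabilisers lie in Gamma^+: a word in R0, R1, R2 fixing a flag has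
   even length (the relators being even, the parity of the length depends only
   on the element of Gamma).  For maps without boundary this is orientability;
   it fails for every map with boundary. *)
Definition orientable : Prop :=
  forall (w : seq 'I_3) (x : flag M),
    (\prod_(i <- w) R M i) x = x -> ~~ odd (size w).

Definition reflections : {set {perm flag M}} :=
  [set r in Aut_map | (r != 1) && [exists x, exists i, r x == R M i x]].

Definition reflection_classes : {set {set {perm flag M}}} :=
  [set r ^: Aut_map | r in reflections].

End Maps.

Definition isomorphic (M N : compact_map) : Prop :=
  exists2 f : flag M -> flag N,
    bijective f & forall i x, f (R M i x) = R N i (f x).

Definition infinitely_many (P : compact_map -> Prop) : Prop :=
  exists M_ : nat -> compact_map,
    (forall n, P (M_ n)) /\ (forall m n, isomorphic (M_ m) (M_ n) -> m = n).

(* Main.v *)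
From HB Require Import structures.
Require Import Defs.
From mathcomp Require Import all_boot all_fingroup.
From mathcomp Require Import ssralg zmodp cyclic.


(** An automorphism of a map is determined by the image of one flag, and each
    edge carries at most four flags.  If no automorphism identifies two of the
    four, an edge-transitive map amounts to a finite group G generated by four
    involutions s_v, indexed by the Klein group V4: the flags
    are the pairs (g, v) in G x V4, R0 and R2 flip the two bits of the colour
    v, and R1 sends (g, v) to (g s_v, v).  Left multiplication by G gives
    automorphisms which are transitive on the edges.  An automorphism which
    changes the colours by a translation of V4 would carry every relation
    between the s_v to the same relation between the translated involutions.
    This cannot happen if the three s_v with v <> 1 commute pairwise and none of
    them commutes with s_1: any nontrivial translation takes some commuting pair
    to a pair that contains s_1 ([Aut_colour]).  Then Aut is exactly G, colours
    separate two classes of vertices and two classes of faces, and the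
    reflections are the conjugates of the s_v.  So the number of classes of
    reflections is the number of conjugacy classes met by the s_v
    ([involution_map_reflection_classes]).  The map is orientable if some
    function to bool changes under multiplication by each s_v, and it is
    non-orientable if some product of an odd number of the s_v is trivial.

    It remains to choose G.  A single family of permutation groups suffices.
    The group V4 acts on five fibres V4 + {None}, each a copy of Z/n with n odd,
    regularly on the first four and trivially on the last; the fourth involution
    swaps two pairs of fibres, with a shift by 1 along one of them.  Its product
    with each of the other three has odd order ([base_odd_order]), so in the
    dihedral groups they generate all four involutions become conjugate, while
    the product of the three involutions of V4 is trivial, a relation of odd
    length.  One of the orders is at least n, so the groups are unbounded.

    Finally each involution d_v is paired with a label e_v in the elementary
    abelian group V4 x C2.  Since labels are central, two pairs are conjugate
    if and only if their labels agree ([pair_class]), so the number of distinct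
    labels is the number k of classes of reflections.  If the labels with v <> 1
    have product 1, the relation of odd length survives and the map is
    non-orientable; if the C2 part of every label is nontrivial, it
    provides an orientation (the orientable double cover). *)

Set Implicit Arguments.
Unset Strict Implicit.
Unset Printing Implicit Defensive.

Local Open Scope group_scope.

(** * The Klein four-group on pairs of bits *)

Definition C2 := bool.
HB.instance Definition _ := Finite.on C2.

Lemma addb_invK : left_inverse (false : C2) id addb.
Proof. by case. Qed.

HB.instance Definition _ :=
  Finite_isGroup.Build C2 addbA addFb addb_invK.

Notation V4 := (C2 * C2)%type.

Lemma V4_mulxx (v : V4) : v * v = 1.
Proof. by case: v => [[] []]. Qed.

Lemma V4_inv (v : V4) : v^-1 = v.
Proof. by apply/eqP; rewrite eq_invg_mul V4_mulxx. Qed.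

(** V4 has more than two elements, so some translation keeps both [u] and [u']
    away from the colour 1, which [s_ncomm] below distinguishes. *)
Lemma V4_avoid (u u' : V4) : exists2 a : V4, u * a != 1 & u' * a != 1.
Proof.
case: u u' => [[] []] [[] []];
  by [exists (false, false) | exists (true, false) | exists (false, true)].
Qed.

(** * Generalities on images, generated groups and automorphisms *)

Lemma ord3P (P : 'I_3 -> Prop) : P i0 -> P i1 -> P i2 -> forall i, P i.
Proof.
move=> P0 P1 P2 [[|[|[|//]]] lti].
- by rewrite (_ : Ordinal lti = i0) //; apply: val_inj.
- by rewrite (_ : Ordinal lti = i1) //; apply: val_inj.
- by rewrite (_ : Ordinal lti = i2) //; apply: val_inj.
Qed.

(** Both images are in bijection with the quotient of [I] by the common kernel
    of [f] and [g]; that quotient is realised here as the image of the pairing. *)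
Lemma eq_card_imset (I A B : finType) (f : I -> A) (g : I -> B) :
    (forall i j, (f i == f j) = (g i == g j)) ->
  #|[set f i | i : I]| = #|[set g i | i : I]|.
Proof.
move=> fg; pose P := [set (f i, g i) | i : I].
have fst_inj : {in P &, injective fst}.
  move=> _ _ /imsetP[i _ ->] /imsetP[j _ ->] /= eq_f.
  by have := fg i j; rewrite eq_f eqxx => /esym/eqP ->.
have snd_inj : {in P &, injective snd}.
  move=> _ _ /imsetP[i _ ->] /imsetP[j _ ->] /= eq_g.
  by have := fg i j; rewrite eq_g eqxx => /eqP ->.
rewrite (_ : [set f i | i : I] = fst @: P); last by rewrite -imset_comp.
rewrite (_ : [set g i | i : I] = snd @: P); last by rewrite -imset_comp.
by rewrite (card_in_imset fst_inj) (card_in_imset snd_inj).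
Qed.

Lemma gen_family_prod (gT : finGroupType) (I : finType) (s : I -> gT) x :
  x \in <<[set s i | i : I]>> -> exists l, x = \prod_(i <- l) s i.
Proof.
case/gen_prodgP=> n [c cP ->].
have cE j : exists i, c j == s i.
  by have /imsetP[i _ ->] := cP j; exists i.
exists [seq xchoose (cE j) | j <- index_enum 'I_n].
rewrite big_map.
by apply: eq_bigr => j _; apply/eqP/(xchooseP (cE j)).
Qed.

Lemma perm_prod_foldl (T : finType) (I : Type) (p : I -> {perm T}) w x :
  (\prod_(i <- w) p i) x = foldl (fun y i => p i y) x w.
Proof.
elim: w x => [|i w IH] x /=; first by rewrite big_nil perm1.
by rewrite big_cons permM IH.
Qed.

Lemma gen_perm_invariant (T : finType) (C : eqType) (c : T -> C)
    (A : {set {perm T}}) p x :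
  (forall q y, q \in A -> c (q y) = c y) -> p \in <<A>> -> c (p x) = c x.
Proof.
move=> cA /gen_prodgP[n [q qA ->]].
elim/big_rec: _ x => [|i r _ IH] x; first by rewrite perm1.
by rewrite permM IH cA.
Qed.

Lemma Aut_mapP (M : compact_map) (f : {perm flag M}) :
  reflect (forall i x, f (R M i x) = R M i (f x)) (f \in Aut_map M).
Proof.
rewrite /Aut_map /= cent_gen; apply: (iffP centP) => [fC i x | fC _ /imsetP[i _ ->]].
  have Ri: R M i \in [set R M j | j : 'I_3] by apply: imset_f.
  by rewrite -!permM fC.
by apply/permP=> x; rewrite !permM fC.
Qed.

Lemma Aut_map_foldl (M : compact_map) (f : {perm flag M}) w x :
  f \in Aut_map M ->
  f (foldl (fun y i => R M i y) x w) = foldl (fun y i => R M i y) (f x) w.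
Proof. by move/Aut_mapP=> fC; elim: w x => //= i w IH x; rewrite IH fC. Qed.

(** The monodromy group is transitive and commutes with automorphisms, so the
    image of one flag spreads to all the others. *)
Lemma Aut_map_inj1 (M : compact_map) (f h : {perm flag M}) x :
  f \in Aut_map M -> h \in Aut_map M -> f x = h x -> f = h.
Proof.
move=> fA hA fhx; apply/permP=> y.
have [p /gen_family_prod[w ->] ->] :=
  atransP2 (R_trans M) (in_setT x) (in_setT y).
by rewrite /= /aperm perm_prod_foldl !Aut_map_foldl // fhx.
Qed.

Lemma Aut_map_orbit (M : compact_map) (f : {perm flag M}) (P : pred 'I_3) x :
  f \in Aut_map M ->
  ('P^*)%act (orbit 'P <<[set R M i | i : 'I_3 & P i]>> x) f
    = orbit 'P <<[set R M i | i : 'I_3 & P i]>> (f x).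
Proof.
move=> fA; rewrite /= /setact /orbit -imset_comp; apply: eq_in_imset => p pG /=.
have: f \in 'C(<<[set R M i | i : 'I_3 & P i]>>).
  apply: subsetP fA; apply: centS; apply: genS.
  by apply/subsetP=> _ /imsetP[i _ ->]; apply: imset_f.
by move/centP/(_ _ pG)=> fp; rewrite /aperm -!permM fp.
Qed.

(** * From unbounded size to infinitely many isomorphism classes *)

Section UnboundedFamily.

Variables (P : compact_map -> Prop) (F : nat -> compact_map).
Hypothesis FP : forall n, P (F n).
Hypothesis F_card : forall n, n < #|flag (F n)|.

Lemma isomorphic_card (M N : compact_map) :
  isomorphic M N -> #|flag M| = #|flag N|.
Proof. by case=> f /bij_eq_card. Qed.

(** Feeding the size of each map back as the next index makes the sizes strictly
    increasing, and isomorphic maps have the same size. *)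
Lemma infinitely_many_unbounded : infinitely_many P.
Proof.
pose c n := iter n (fun c => #|flag (F c)|) 0.
have c_mono : {mono c : m n / m <= n}.
  by apply: leq_mono; apply: homo_ltn => [y x z|n]; [apply: ltn_trans | apply: F_card].
exists (fun n => F (c n)); split=> // m n /isomorphic_card eq_card.
exact/succn_inj/(incn_inj c_mono).
Qed.

End UnboundedFamily.
(** * The map of four involutions *)

Section MapOfInvolutions.

Variables (gT : finGroupType) (s : V4 -> gT).
Hypothesis s_invol : forall v, s v * s v = 1.
Hypothesis s_gen : forall g, exists l, g = \prod_(v <- l) s v.

Definition step (i : 'I_3) (x : gT * V4) : gT * V4 :=
  match val i with
  | 0 => (x.1, (~~ x.2.1, x.2.2))
  | 1 => (x.1 * s x.2, x.2)
  | _ => (x.1, (x.2.1, ~~ x.2.2))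
  end.

Lemma stepK i : involutive (step i).
Proof.
by elim/ord3P: i => -[g [x y]]; rewrite /step /= ?negbK // -mulgA s_invol mulg1.
Qed.

Definition step_perm i : {perm gT * V4} := perm (can_inj (stepK i)).

Lemma step_permE i x : step_perm i x = step i x.
Proof. exact: permE. Qed.

Lemma step_perm_invol i : step_perm i ^+ 2 = 1.
Proof. by apply/permP=> x; rewrite expgS permM !step_permE stepK perm1. Qed.

Lemma step_perm02_invol : (step_perm i0 * step_perm i2) ^+ 2 = 1.
Proof.
apply/permP=> -[g [x y]].
by rewrite expgS !permM !step_permE /step /= !negbK perm1.
Qed.

(** The word in R0 and R2 that translates the colour of every flag by [d]. *)
Definition colour_word (d : V4) : seq 'I_3 := nseq d.1 i0 ++ nseq d.2 i2.

(** A word in the involutions is turned into a word in the R_i by moving to the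
    colour of each letter, applying R1 and moving back.  The letters are offsets
    from the colour of the starting flag, so that one word in the R_i can be
    compared at flags of different colours. *)
Definition lift_word (l : seq V4) : seq 'I_3 :=
  flatten [seq colour_word d ++ i1 :: colour_word d | d <- l].

Lemma lift_word_cons d l :
  lift_word (d :: l) = colour_word d ++ i1 :: colour_word d ++ lift_word l.
Proof. by rewrite /lift_word map_cons [LHS]/= -catA. Qed.

Definition run w x := foldl (fun y i => step i y) x w.

Lemma prod_step_perm w x : (\prod_(i <- w) step_perm i) x = run w x.
Proof.
rewrite perm_prod_foldl; elim: w x => //= i w IH x.
by rewrite IH step_permE.
Qed.

Lemma run_cat w1 w2 x : run (w1 ++ w2) x = run w2 (run w1 x).
Proof. exact: foldl_cat. Qed.

Lemma run_cons i w x : run (i :: w) x = run w (step i x).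
Proof. by []. Qed.

Lemma run_colour_word d g u : run (colour_word d) (g, u) = (g, u * d).
Proof. by case: d u => [[] []] [[] []]. Qed.

Lemma run_lift_word l g u :
  run (lift_word l) (g, u) = (g * \prod_(d <- l) s (u * d), u).
Proof.
elim: l g => [|d l IH] g; first by rewrite big_nil mulg1.
rewrite lift_word_cons run_cat run_cons run_cat.
rewrite run_colour_word [step _ _]/= run_colour_word -(mulgA u) V4_mulxx mulg1.
by rewrite IH big_cons mulgA.
Qed.

(** Each letter contributes R1 between two copies of the same word. *)
Lemma odd_size_lift_word l : odd (size (lift_word l)) = odd (size l).
Proof.
elim: l => //= d l IH.
rewrite lift_word_cons size_cat oddD [size (_ :: _)]/= size_cat oddS oddD IH.
by rewrite addbN addKb.
Qed.

Lemma step_transitive :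
  [transitive <<[set step_perm i | i : 'I_3]>>, on [set: gT * V4] | 'P].
Proof.
set G := <<_>>; apply/imsetP; exists (1, 1); rewrite ?inE //.
apply/setP=> -[g v]; rewrite inE; symmetry; apply/orbitP.
have [l ->] := s_gen g.
pose w := lift_word l ++ colour_word v.
exists (\prod_(i <- w) step_perm i).
  by apply: group_prod => i _; apply/mem_gen/imset_f.
rewrite /= /aperm prod_step_perm run_cat run_lift_word run_colour_word !mul1g.
by congr (_, _); apply: eq_bigr => d _; rewrite mul1g.
Qed.

Definition involution_map : compact_map :=
  CompactMap step_perm_invol step_perm02_invol step_transitive.

Local Notation M := involution_map.

Lemma foldl_R w (x : flag M) : foldl (fun y i => R M i y) x w = run w x.
Proof. by rewrite -prod_step_perm perm_prod_foldl. Qed.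

Lemma involution_map_card : #|flag M| = (#|gT| * 4)%N.
Proof. by rewrite card_prod card_prod card_bool. Qed.

Lemma involution_map_without_boundary :
  (forall v, s v != 1) -> without_boundary M.
Proof.
move=> s_neq1; apply/forallP=> i; apply/forallP=> -[g [x y]].
rewrite /= step_permE; elim/ord3P: i; rewrite /step /=.
- by rewrite xpair_eqE eqxx xpair_eqE; case: x.
- by rewrite xpair_eqE eqxx andbT -{2}[g]mulg1 (inj_eq (mulgI g)) s_neq1.
- by rewrite xpair_eqE eqxx xpair_eqE; case: y; rewrite andbF.
Qed.

(** The parity [p] together with the two bits of the colour is a 2-colouring of
    the flags which every R_i reverses. *)
Lemma involution_map_orientable (p : gT -> bool) :
  (forall g v, p (g * s v) = ~~ p g) -> orientable M.
Proof.
move=> ps w x; rewrite prod_step_perm => run_x.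
pose c (y : gT * V4) := p y.1 (+) y.2.1 (+) y.2.2.
have c_run v y : c (run v y) = odd (size v) (+) c y.
  elim: v y => // i v IH y; rewrite run_cons IH oddS addNb -addbN.
  congr (_ (+) _); elim/ord3P: i; rewrite /c /step /= ?ps.
  - by rewrite addbN addNb.
  - by rewrite !addNb.
  - by rewrite addbN.
have := c_run w x; rewrite run_x.
by case: (odd _); case: (c x).
Qed.

Lemma involution_map_nonorientable (l : seq V4) :
  odd (size l) -> \prod_(v <- l) s v = 1 -> ~ orientable M.
Proof.
move=> odd_l prod_l /(_ (lift_word l) (1, 1)).
rewrite prod_step_perm run_lift_word odd_size_lift_word odd_l.
under eq_bigr do rewrite mul1g.
by rewrite prod_l mulg1 => /(_ erefl).
Qed.

(** ** Automorphisms *)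

Definition left_mul (h : gT) (x : gT * V4) : gT * V4 := (h * x.1, x.2).

Lemma left_mul_inj h : injective (left_mul h).
Proof. by move=> [g u] [g' u'] [/mulgI -> ->]. Qed.

Definition left_perm h : {perm flag M} := perm (@left_mul_inj h).

Lemma left_permE h x : left_perm h x = left_mul h x.
Proof. exact: permE. Qed.

Lemma left_perm_Aut h : left_perm h \in Aut_map M.
Proof.
apply/Aut_mapP=> i [g u] /=; rewrite !left_permE !step_permE.
by elim/ord3P: i; rewrite /step /left_mul /= ?mulgA.
Qed.

Lemma left_permM h k : left_perm h * left_perm k = left_perm (k * h).
Proof.
by apply/permP=> x; rewrite permM !left_permE /left_mul /= mulgA.
Qed.

Lemma left_perm_inj : injective left_perm.
Proof.
move=> h k /permP/(_ (1, 1)); rewrite !left_permE => -[].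
by rewrite !mulg1.
Qed.

Lemma left_permV h : (left_perm h)^-1 = left_perm h^-1.
Proof.
apply/eqP; rewrite eq_invg_mul left_permM mulVg; apply/eqP/permP=> x.
by rewrite left_permE perm1 /left_mul mul1g -surjective_pairing.
Qed.

Lemma Aut_fix_colour f x : f \in Aut_map M -> (f x).2 = x.2 ->
  f = left_perm ((f x).1 * x.1^-1).
Proof.
move=> fA eq_c; apply: (Aut_map_inj1 fA (left_perm_Aut _) (x := x)).
by rewrite left_permE /left_mul mulgKV -eq_c -surjective_pairing.
Qed.

(** An automorphism commutes with the word in the R_i that spells a relation at
    colour [u], and that same word spells the translated relation at the colour
    [u'] of the image. *)
Lemma Aut_shift_relation f g u h u' l :
    f \in Aut_map M -> f (g, u) = (h, u') ->
  \prod_(v <- [seq u * d | d <- l]) s v = 1 ->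
  \prod_(v <- [seq u' * d | d <- l]) s v = 1.
Proof.
rewrite !big_map => fA fx rel_u; have := Aut_map_foldl (lift_word l) ((g, u) : flag M) fA.
rewrite !foldl_R fx !run_lift_word rel_u mulg1 fx => -[] /eqP.
by rewrite -{1}[h]mulg1 (inj_eq (mulgI h)) => /eqP.
Qed.

(** The asymmetry that singles out the colour 1. *)
Hypothesis s_comm : forall u v, u != 1 -> v != 1 -> s u * s v = s v * s u.
Hypothesis s_ncomm : forall u, u != 1 -> s u * s 1 != s 1 * s u.

Lemma s_inv v : (s v)^-1 = s v.
Proof. by apply/eqP; rewrite eq_invg_mul s_invol. Qed.

(** For involutions, commutation is a relation of length four, to which
    [Aut_shift_relation] applies. *)
Lemma commute_relation u v :
  (\prod_(d <- [:: u; v; u; v]) s d == 1) = (s u * s v == s v * s u).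
Proof.
rewrite !big_cons big_nil mulg1 mulgA -eq_invg_mul invMg !s_inv.
exact: eq_sym.
Qed.

(** If [f] moved the colour [u] to [u'], then the commuting pair of colours
    [u * a] and [u * u'] would be taken to [u' * a] and [u' * u' = 1]. *)
Lemma Aut_colour f (x : flag M) : f \in Aut_map M -> (f x).2 = x.2.
Proof.
case: x => g u fA; case fx: (f (g, u)) => [h u'] /=.
apply/eqP/negPn/negP=> neq_u.
have [a neq_au neq_au'] := V4_avoid u u'.
have neq_b : u * u' != 1 by rewrite -eq_invg_mul V4_inv eq_sym.
have := Aut_shift_relation (l := [:: a; u'; a; u']) fA fx.
rewrite !map_cons [map _ [::]]/=.
have /eqP -> : \prod_(v <- [:: u * a; u * u'; u * a; u * u']) s v == 1.
  by rewrite commute_relation s_comm.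
by move/(_ erefl)/eqP; rewrite commute_relation V4_mulxx (negPf (s_ncomm _)).
Qed.

Lemma AutE f : f \in Aut_map M -> exists h, f = left_perm h.
Proof.
by move=> fA; have := Aut_fix_colour fA (Aut_colour (1, 1) fA); exists ((f (1, 1)).1 * 1^-1).
Qed.

(** ** Cells and reflections *)

Lemma involution_map_edge_transitive : edge_transitive M.
Proof.
pose E x := orbit 'P <<[set R M i | i : 'I_3 & i != i1]>> x.
have E_colour g u : E (g, u) = E (g, 1).
  apply/orbit_eqP/orbitP; exists (\prod_(i <- colour_word u) R M i).
    rewrite big_seq group_prod // => i; rewrite mem_cat !mem_nseq => i_in.
    apply/mem_gen/imset_f; rewrite !inE.
    by case/orP: i_in => /andP[_ /eqP->].
  by rewrite /= /aperm prod_step_perm run_colour_word mul1g.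
apply/imsetP; exists (E (1, 1)); first exact: imset_f.
apply/setP=> A; apply/imsetP/orbitP.
  case=> -[g u] _ ->; rewrite -/(E _) E_colour.
  exists (left_perm g); first exact: left_perm_Aut.
  by rewrite Aut_map_orbit ?left_perm_Aut // left_permE /left_mul mulg1.
case=> f fA <-; exists (f (1, 1)) => //.
exact: Aut_map_orbit.
Qed.

(** Automorphisms preserve colours, so a function of the colour that is constant
    on the [d]-cells separates orbits of cells as soon as it is not constant. *)
Lemma cells_not_transitive d (c : V4 -> C2) u :
  (forall i x, i != d -> c (R M i x).2 = c x.2) -> c u != c 1 ->
  ~~ [transitive Aut_map M, on cells M d | 'P^*].
Proof.
pose E x := orbit 'P <<[set R M i | i : 'I_3 & i != d]>> x.
move=> c_inv neq_c; apply/negP=> trE.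
have E_cell x : E x \in cells M d by apply: imset_f.
have [f fA fE] := atransP2 trE (E_cell (1, 1)) (E_cell (1, u)).
have: (1, u) \in E (f (1, 1)).
  by rewrite /E -Aut_map_orbit // -/(E _) -fE orbit_refl.
case/orbitP=> p pG; rewrite /= /aperm => fu; move/eqP: neq_c; apply.
have /= := gen_perm_invariant (c := fun x : flag M => c x.2) (f (1, 1)) _ pG.
rewrite fu (Aut_colour (1, 1) fA); apply=> q y /imsetP[i].
by rewrite inE => ne_i ->; apply: c_inv.
Qed.

Lemma involution_map_just_edge_transitive : just_edge_transitive M.
Proof.
apply/and3P; split; first exact: involution_map_edge_transitive.
  apply: (@cells_not_transitive i0 fst (true, false)) => // i x.
  by rewrite /= step_permE; elim/ord3P: i.
apply: (@cells_not_transitive i2 snd (false, true)) => // i x.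
by rewrite /= step_permE; elim/ord3P: i.
Qed.

(** Only R1 preserves colours, so a reflection agrees with R1 at some flag
    [(g, u)], and then it is left multiplication by [g * s u * g^-1]. *)
Lemma reflectionsE (f : {perm flag M}) : (forall v, s v != 1) ->
  reflect (exists h v, f = left_perm (s v ^ h)) (f \in reflections M).
Proof.
move=> s_neq1; rewrite inE; apply: (iffP and3P).
  case=> fA _ /existsP[[g u] /existsP[i /eqP fx]].
  have fc := Aut_colour (g, u) fA; exists g^-1, u.
  rewrite (Aut_fix_colour fA fc) fx /= step_permE conjgE invgK /=.
  have: (step i (g, u)).2 = u by rewrite -step_permE -[RHS]fc fx.
  elim/ord3P: i {fx}; rewrite /step /= ?mulgA //.
    by case: (u) => [[] ?].
  by case: (u) => [? []].
case=> h [v ->]; split; first exact: left_perm_Aut.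
  apply: contra (s_neq1 v) => /eqP/permP/(_ (1, 1)).
  by rewrite left_permE perm1 => -[/eqP]; rewrite mulg1 conjg_eq1.
apply/existsP; exists (h^-1, v); apply/existsP; exists i1.
by rewrite left_permE /= step_permE /step /left_mul /= conjgE -!mulgA mulgV mulg1.
Qed.

(** Left multiplication reverses products, which turns conjugation by [g] into
    conjugation by [g^-1] and leaves conjugacy classes unchanged. *)
Lemma left_perm_class h k :
  (left_perm h \in left_perm k ^: Aut_map M) = (h \in k ^: [set: gT]).
Proof.
have left_perm_conj g : left_perm k ^ left_perm g = left_perm (k ^ g^-1).
  by rewrite !conjgE left_permV !left_permM invgK mulgA.
apply/imsetP/imsetP=> [[f fA]|[g _ ->]].
  have [g ->] := AutE fA; rewrite left_perm_conj => /left_perm_inj ->.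
  by exists g^-1; rewrite ?inE.
exists (left_perm g^-1); first exact: left_perm_Aut.
by rewrite left_perm_conj invgK.
Qed.

Lemma involution_map_reflection_classes (C : finType) (e : V4 -> C) :
    (forall v, s v != 1) ->
    (forall u v, (s u \in s v ^: [set: gT]) = (e u == e v)) ->
  #|reflection_classes M| = #|[set e v | v : V4]|.
Proof.
move=> s_neq1 s_class.
pose cl v := left_perm (s v) ^: Aut_map M.
have cl_eq u v : (cl u == cl v) = (e u == e v).
  rewrite -s_class -left_perm_class.
  by rewrite /cl; apply/eqP/idP=> [<-|/class_eqP //]; rewrite class_refl.
have -> : reflection_classes M = [set cl v | v : V4].
  apply/setP=> A; apply/imsetP/imsetP=> [[f /reflectionsE]|[v _ ->]].
    case=> // h [v ->] ->; exists v => //; apply/class_eqP.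
    by rewrite left_perm_class memJ_class ?inE.
  exists (left_perm (s v)) => //; apply/reflectionsE => //.
  by exists 1, v; rewrite conjg1.
exact: eq_card_imset.
Qed.

End MapOfInvolutions.

(** * Conjugate involutions with central labels *)

(** In a dihedral group of odd order all reflections are conjugate: with
    [c = x * y] one has [x ^ (c ^+ i) = x * c ^+ (2 * i)], and for
    [2 * i = n + 1] this is [x * c = y]. *)
Lemma conj_of_odd_order (gT : finGroupType) (x y : gT) n :
  x * x = 1 -> y * y = 1 -> (x * y) ^+ n = 1 -> odd n ->
  y = x ^ ((x * y) ^+ n.+1./2).
Proof.
move=> xx yy xyn odd_n; set c := x * y.
have inv (z : gT) : z * z = 1 -> z^-1 = z.
  by move=> zz; apply/eqP; rewrite eq_invg_mul zz.
have cx : c ^ x = c^-1.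
  by rewrite /c conjgE invMg !inv // !mulgA xx mul1g.
have xc i : x ^ (c ^+ i) = x * c ^+ (i + i).
  have {}cx: (c ^+ i) ^ x = c ^- i by rewrite conjXg cx expgVn.
  by rewrite conjgE -cx conjgE -!mulgA (mulgA x x) xx mul1g inv // expgD.
rewrite xc addnn even_halfK ?oddS ?odd_n // expgS xyn mulg1.
by rewrite mulgA xx mul1g.
Qed.

Section LabelledInvolutions.

Variables (hT eT : finGroupType) (d : V4 -> hT) (e : V4 -> eT).
Hypothesis d_invol : forall v, d v * d v = 1.
Hypothesis d_neq1 : forall v, d v != 1.
Hypothesis d_comm : forall u v, u != 1 -> v != 1 -> d u * d v = d v * d u.
Hypothesis d_ncomm : forall u, u != 1 -> d u * d 1 != d 1 * d u.
Hypothesis d_conj :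
  forall v, exists2 h, h \in <<[set d v | v : V4]>> & d 1 = d v ^ h.
Hypothesis e_abelian : forall x y : eT, x * y = y * x.
Hypothesis e_invol : forall v, e v * e v = 1.

(** The subgroup of [hT * eT] generated by the labelled involutions.  It may be
    smaller than the product, but it projects onto the group generated by the
    [d v], which is all that conjugacy requires. *)
Definition pair_group : {group hT * eT} := <<[set (d v, e v) | v : V4]>>%G.

Definition pair_gen (v : V4) : subg_of pair_group := subg pair_group (d v, e v).

Lemma pair_genE v : sgval (pair_gen v) = (d v, e v).
Proof. by rewrite subgK // mem_gen // imset_f. Qed.

Lemma pair_invol v : pair_gen v * pair_gen v = 1.
Proof.
apply: val_inj.
rewrite -[LHS]/(sgval (pair_gen v) * sgval (pair_gen v)) pair_genE.
by rewrite -[RHS]/(1, 1) -(d_invol v) -(e_invol v).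
Qed.

Lemma pair_generated g : exists l, g = \prod_(v <- l) pair_gen v.
Proof.
have [l gE] := gen_family_prod (subgP g); exists l; apply: val_inj.
have sgval_prod : sgval (\prod_(v <- l) pair_gen v) = \prod_(v <- l) sgval (pair_gen v).
  exact: (big_morph (@sgval _ pair_group) (fun x y => erefl _) (erefl _)).
rewrite /= gE [RHS]sgval_prod.
by apply: eq_bigr => v _; rewrite pair_genE.
Qed.

Definition proj_d (g : subg_of pair_group) : hT := (sgval g).1.
Definition proj_e (g : subg_of pair_group) : eT := (sgval g).2.

Lemma proj_dM : {morph proj_d : g h / g * h}. Proof. by []. Qed.
Lemma proj_eM : {morph proj_e : g h / g * h}. Proof. by []. Qed.

Lemma proj_dJ : {morph proj_d : g h / g ^ h}. Proof. by []. Qed.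
Lemma proj_eJ : {morph proj_e : g h / g ^ h}. Proof. by []. Qed.

Lemma proj_d_gen v : proj_d (pair_gen v) = d v.
Proof. by rewrite /proj_d pair_genE. Qed.

Lemma proj_e_gen v : proj_e (pair_gen v) = e v.
Proof. by rewrite /proj_e pair_genE. Qed.

Lemma pair_eq g h : proj_d g = proj_d h -> proj_e g = proj_e h -> g = h.
Proof.
move=> eq_d eq_e; apply: val_inj.
rewrite /= (surjective_pairing (sgval g)) (surjective_pairing (sgval h)).
by congr (_, _).
Qed.

Lemma pair_neq1 v : pair_gen v != 1.
Proof.
by apply: contraNneq (d_neq1 v) => eq1; rewrite -proj_d_gen eq1.
Qed.

Lemma pair_comm u v : u != 1 -> v != 1 ->
  pair_gen u * pair_gen v = pair_gen v * pair_gen u.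
Proof.
move=> u1 v1; apply: pair_eq; last by rewrite !proj_eM e_abelian.
by rewrite !proj_dM !proj_d_gen d_comm.
Qed.

Lemma pair_ncomm u : u != 1 ->
  pair_gen u * pair_gen 1 != pair_gen 1 * pair_gen u.
Proof.
move=> u1; apply: contraNneq (d_ncomm u1) => /(congr1 proj_d).
by rewrite !proj_dM !proj_d_gen => ->.
Qed.

Lemma proj_d_onto h : h \in <<[set d v | v : V4]>> -> exists g, proj_d g = h.
Proof.
case/gen_family_prod=> l ->; exists (\prod_(v <- l) pair_gen v).
rewrite (big_morph _ proj_dM (erefl _)).
by apply: eq_bigr => v _; rewrite proj_d_gen.
Qed.

(** Labels are central, hence invariant under conjugation; conversely a
    conjugating element for the [d]-components lifts to [pair_group] whatever its
    label, and does not affect the labels. *)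
Lemma pair_class u v :
  (pair_gen u \in pair_gen v ^: [set: _]) = (e u == e v).
Proof.
have conj_e (x y : eT) : x ^ y = x by rewrite conjgE e_abelian mulgK.
apply/imsetP/eqP => [[g _ /(congr1 proj_e)]|eq_e].
  by rewrite proj_eJ !proj_e_gen conj_e.
have [h hG d_u] := d_conj u; have [k kG d_v] := d_conj v.
have [g gE] : exists g, proj_d g = k * h^-1.
  by apply: proj_d_onto; rewrite groupM ?groupV.
exists g; rewrite ?inE //; apply: pair_eq.
  by rewrite proj_dJ !proj_d_gen gE conjgM -d_v d_u conjgK.
by rewrite proj_eJ !proj_e_gen eq_e conj_e.
Qed.

Lemma pair_order u v : #[d u * d v] <= #|subg_of pair_group|.
Proof.
apply: (@leq_trans #[pair_gen u * pair_gen v]); last exact: max_card.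
apply: dvdn_leq; first exact: order_gt0.
rewrite order_dvdn -!proj_d_gen -proj_dM.
have projX g i : proj_d (g ^+ i) = proj_d g ^+ i.
  by elim: i => // i IH; rewrite !expgS proj_dM IH.
by rewrite -projX expg_order.
Qed.

Definition labelled_map := involution_map pair_invol pair_generated.

Lemma labelled_map_card u v : #[d u * d v] < #|flag labelled_map|.
Proof.
rewrite involution_map_card; apply: leq_ltn_trans (pair_order u v) _.
by rewrite -[X in X < _]muln1 ltn_pmul2l // (cardD1 1).
Qed.

Lemma labelled_mapP :
  [/\ just_edge_transitive labelled_map, without_boundary labelled_map
    & #|reflection_classes labelled_map| = #|[set e v | v : V4]|].
Proof.
split.
- exact: involution_map_just_edge_transitive pair_comm pair_ncomm.
- exact: involution_map_without_boundary pair_neq1.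
- exact: involution_map_reflection_classes pair_comm pair_ncomm _ _ pair_neq1 pair_class.
Qed.

Lemma labelled_map_orientable (p : eT -> bool) :
  (forall x v, p (x * e v) = ~~ p x) -> orientable labelled_map.
Proof.
move=> pe; apply: (@involution_map_orientable _ _ _ _ (p \o proj_e)) => g v.
by rewrite /= proj_eM proj_e_gen.
Qed.

Lemma labelled_map_nonorientable (l : seq V4) :
  odd (size l) -> \prod_(v <- l) d v = 1 -> \prod_(v <- l) e v = 1 ->
  ~ orientable labelled_map.
Proof.
move=> odd_l prod_d prod_e; apply: (involution_map_nonorientable odd_l).
apply: pair_eq.
  rewrite (big_morph _ proj_dM (erefl _)) -[RHS]prod_d.
  by apply: eq_bigr => v _; rewrite proj_d_gen.
rewrite (big_morph _ proj_eM (erefl _)) -[RHS]prod_e.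
by apply: eq_bigr => v _; rewrite proj_e_gen.
Qed.

End LabelledInvolutions.

(** * An unbounded family of base groups *)

Section TwistedTransposition.

Variable m : nat.
Local Notation n := m.*2.+1.
Local Notation Zn := 'I_n.

Definition point : finType := (option V4 * Zn)%type.

(** [Zp1] rather than the unit of a ring, because 'I_1 (the case [m = 0]) has no
    ring structure. *)
Definition z1 : Zn := Zp1.

Definition shift_fun (v : V4) (x : point) : point := (omap (mulg v) x.1, x.2).

(** Forgetting the second coordinate, the shifts and the twist generate the
    alternating group of degree 5, in which this double transposition does not
    commute with any of the shifts.  The shift by [z1] makes the loop formed by
    the first two fibres contribute an element of order [n]. *)
Definition twist_fun (x : point) : point :=
  match x with
  | (Some (false, false), k) => (Some (true, false), (k + z1)%R)
  | (Some (true, false), k) => (Some (false, false), (k - z1)%R)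
  | (Some (false, true), k) => (None, k)
  | (None, k) => (Some (false, true), k)
  | _ => x
  end.

Lemma shift_funK v : involutive (shift_fun v).
Proof. by move=> [[u|] k]; rewrite /shift_fun //= mulgA V4_mulxx mul1g. Qed.

Lemma twist_funK : involutive twist_fun.
Proof.
by move=> [[[[] []]|] k] //=; rewrite ?GRing.addrK ?GRing.subrK.
Qed.

Definition shift v : {perm point} := perm (can_inj (shift_funK v)).
Definition twist : {perm point} := perm (can_inj twist_funK).

Definition base (v : V4) : {perm point} := if v == 1 then twist else shift v.

Lemma base_invol v : base v * base v = 1.
Proof.
rewrite /base; case: (v == 1); apply/permP=> x; rewrite permM !permE /=.
  exact: twist_funK.
exact: shift_funK.
Qed.

Lemma base_neq1 v : base v != 1.
Proof.
rewrite /base; case: (eqVneq v 1) => [_|v1]; apply/negP=> /eqP/permP.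
  by move/(_ (None, 0%R)); rewrite !permE.
by move/(_ (Some 1, 0%R)); rewrite !permE; case: v v1 => [[] []].
Qed.

Lemma base_comm u v : u != 1 -> v != 1 -> base u * base v = base v * base u.
Proof.
move=> u1 v1; rewrite /base (negPf u1) (negPf v1); apply/permP=> -[[w|] k];
  rewrite !permM !permE /shift_fun //=.
by case: u v w {u1 v1} => [[] []] [[] []] [[] []].
Qed.

Lemma base_ncomm u : u != 1 -> base u * base 1 != base 1 * base u.
Proof.
move=> u1; apply/negP=> /eqP/permP/(_ (None, 0%R)).
rewrite !permM /base eqxx (negPf u1) !permE /=.
by case: u u1 => [[] []].
Qed.

Lemma base_prod3 : base (true, false) * base (false, true) * base (true, true) = 1.
Proof.
by apply/permP=> -[[w|] k]; rewrite !permM /base /= !permE /shift_fun //=;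
  case: w => [[] []].
Qed.

Lemma Zn_mulrn (k : Zn) : (k *+ n = 0)%R.
Proof. by rewrite Zp_mulrn; apply: val_inj; rewrite /= modnMl. Qed.

(** If [p ^+ q] preserves every fibre it acts on it by a translation, which has
    order dividing [n]. *)
Lemma fibre_shift_order (p : {perm point}) q (s : option V4 -> Zn) :
  (forall a k, iter q p (a, k) = (a, k + s a)%R) -> p ^+ (q * n) = 1.
Proof.
move=> p_q; rewrite expgM; apply/permP=> -[a k].
have pX j : ((p ^+ q) ^+ j) (a, k) = (a, k + s a *+ j)%R.
  elim: j => [|j IH]; first by rewrite perm1 GRing.addr0.
  by rewrite expgSr permM IH permX p_q -GRing.addrA GRing.mulrSr.
by rewrite pX Zn_mulrn GRing.addr0 perm1.
Qed.

(** The product permutes the fibres in a 5-cycle whose shifts cancel, except for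
    [v = (true, false)]: then the two fibres joined by the shifted twist are fixed
    and translated in opposite directions, and the other three form a 3-cycle. *)
Lemma base_odd_order v : v != 1 ->
  exists2 r, odd r & (base v * base 1) ^+ r = 1.
Proof.
move=> v1; have odd_n : odd n by rewrite oddS odd_double.
have stepE x : (base v * base 1) x = twist_fun (shift_fun v x).
  by rewrite permM /base (negPf v1) eqxx !permE.
have iterE q x : iter q (base v * base 1) x = iter q (fun y => twist_fun (shift_fun v y)) x.
  exact: eq_iter.
case: v v1 {stepE} iterE => [[] []] // _ iterE.
- exists (5 * n)%N; first by rewrite oddM odd_n.
  apply: (@fibre_shift_order _ _ (fun=> 0%R)) => a k.
  rewrite iterE GRing.addr0.
  by case: a => [[[] []]|] /=; rewrite ?GRing.addrK ?GRing.subrK.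
- exists (3 * n)%N; first by rewrite oddM odd_n.
  (* A cube translates the two fixed fibres three times. *)
  pose s (a : option V4) : Zn :=
    match a with
    | Some (false, false) => (- z1 - z1 - z1)%R
    | Some (true, false) => (z1 + z1 + z1)%R
    | _ => 0%R
    end.
  apply: (@fibre_shift_order _ _ s) => a k; rewrite iterE.
  by case: a => [[[] []]|] /=; rewrite ?GRing.addr0 ?GRing.addrA.
- exists (5 * n)%N; first by rewrite oddM odd_n.
  apply: (@fibre_shift_order _ _ (fun=> 0%R)) => a k.
  rewrite iterE GRing.addr0.
  by case: a => [[[] []]|] /=; rewrite ?GRing.addrK ?GRing.subrK.
Qed.

Lemma base_conj v :
  exists2 h, h \in <<[set base v | v : V4]>> & base 1 = base v ^ h.
Proof.
have base_in u : base u \in <<[set base v | v : V4]>>.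
  by apply/mem_gen/imset_f.
case: (eqVneq v 1) => [->|v1]; first by exists 1; rewrite ?group1 ?conjg1.
have [r odd_r rel] := base_odd_order v1.
exists ((base v * base 1) ^+ r.+1./2); first by rewrite groupX ?groupM.
exact: conj_of_odd_order (base_invol v) (base_invol 1) rel odd_r.
Qed.

(** On the fibre over 1 this product is the translation by [- z1]. *)
Lemma base_order : n <= #[base (true, false) * base 1].
Proof.
set c := base _ * _.
have cX j : (c ^+ j) (Some 1, 0%R) = (Some 1, (- z1 *+ j)%R).
  elim: j => [|j IH]; first by rewrite perm1 GRing.mulr0n.
  by rewrite expgSr permM IH permM /base /= !permE GRing.mulrSr.
apply: dvdn_leq; first exact: order_gt0.
have := cX #[c]; rewrite expg_order perm1 => -[/esym/eqP].
rewrite GRing.mulNrn GRing.oppr_eq0 /z1 Zp_mulrn => /eqP/(congr1 val) /=.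
by rewrite modnMml mul1n => /eqP.
Qed.

End TwistedTransposition.

(** * Labels and the resulting maps *)

(** For [1 <= k <= 4] these take exactly [k] values, and the labels of the three
    nontrivial elements of V4 have product 1; the latter preserves the odd
    relation [base_prod3]. *)
Definition label (k : nat) (v : V4) : V4 :=
  match k with
  | 1 => (1 : V4)
  | 2 => if v == 1 then (true, false) else (1 : V4)
  | 3 => if v == 1 then (true, false) else (false, v.2)
  | _ => v
  end.

(** The bit [o] is the common C2 part of the labels: with [o = true] it records
    the parity of the length of a word. *)
Definition signed_label (k : nat) (o : C2) (v : V4) : V4 * C2 := (label k v, o).

Lemma card_signed_label k o : 1 <= k <= 4 ->
  #|[set signed_label k o v | v : V4]| = k.
Proof.
move=> k_bound; have -> : #|[set signed_label k o v | v : V4]| = #|[set label k v | v : V4]|.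
  by apply: eq_card_imset => u v; rewrite xpair_eqE eqxx andbT.
case: k k_bound => [|[|[|[|[|//]]]]] // _.
- rewrite (_ : [set _ | _ : _] = [set (1 : V4)]) ?cards1 //.
  by apply/setP=> w; rewrite inE; apply/imsetP/eqP=> [[]|->] //; exists 1.
- rewrite (_ : [set _ | _ : _] = [set (1 : V4); (true, false) : V4]) ?cards2 //.
  apply/setP=> w; rewrite !inE; apply/imsetP/orP=> [[v _ ->] /=|].
    by case: ifP; [right | left].
  by case=> /eqP->; [exists (true, true) | exists 1].
- rewrite (_ : [set _ | _ : _] = [set~ ((true, true) : V4)]) ?cardsC1 ?card_prod ?card_bool //.
  apply/setP=> w; rewrite !inE; apply/imsetP/idP=> [[[[] []] _ ->]|] //.
  case: w => [[] []] // _; [by exists 1 | by exists (false, true) | by exists (true, false)].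
- by rewrite card_imset ?card_prod ?card_bool.
Qed.

Lemma signed_label_invol k o v : signed_label k o v * signed_label k o v = 1.
Proof. by rewrite -[LHS]/(_ * _, _ * _) V4_mulxx; case: o. Qed.

Lemma signed_label_abelian (x y : V4 * C2) : x * y = y * x.
Proof. by case: x y => [[[] []] []] [[[] []] []]. Qed.

Definition family (k : nat) (o : C2) (m : nat) : compact_map :=
  labelled_map (@base_invol m) (signed_label_invol k o).

Lemma familyP k o m : 1 <= k <= 4 ->
  [/\ just_edge_transitive (family k o m), without_boundary (family k o m)
    & #|reflection_classes (family k o m)| = k].
Proof.
move=> k_bound.
have [] := labelled_mapP (@base_invol m) (@base_neq1 m) (@base_comm m)
  (@base_ncomm m) (@base_conj m) signed_label_abelian (signed_label_invol k o).
by rewrite card_signed_label.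
Qed.

Lemma family_card k o m : m < #|flag (family k o m)|.
Proof.
apply: leq_ltn_trans (labelled_map_card _ _ (true, false) 1).
apply: leq_trans (base_order m).
by rewrite leqW // -addnn leq_addr.
Qed.

Lemma family_orientable k m : orientable (family k true m).
Proof.
apply: (labelled_map_orientable (p := fun x : V4 * C2 => x.2)) => -[x b] v.
exact: addbT.
Qed.

Lemma family_nonorientable k m : 1 <= k <= 4 -> ~ orientable (family k false m).
Proof.
move=> k_bound.
apply: (@labelled_map_nonorientable _ _ _ _ _ _
  [:: (true, false); (false, true); (true, true)]) => //.
  by rewrite !big_cons big_nil mulg1 mulgA base_prod3.
rewrite !big_cons big_nil.
by case: k k_bound => [|[|[|[|[|]]]]].
Qed.

(** * Existence of the maps *)

Local Close Scope group_scope.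

Theorem theorem5p1 (k : nat) (hk : 1 <= k <= 4) :
  infinitely_many (fun M : compact_map =>
    [/\ just_edge_transitive M, without_boundary M,
        #|reflection_classes M| = k & orientable M])
  /\
  infinitely_many (fun M : compact_map =>
    [/\ just_edge_transitive M, without_boundary M,
        #|reflection_classes M| = k & ~ orientable M]).
Proof.
split.
  apply: (@infinitely_many_unbounded _ (family k true)) => m; last exact: family_card.
  by have [? ? ?] := familyP true m hk; split=> //; apply: family_orientable.
apply: (@infinitely_many_unbounded _ (family k false)) => m; last exact: family_card.
by have [? ? ?] := familyP false m hk; split=> //; apply: family_nonorientable.
Qed.
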